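(* Let $X$ be a metrizable space, and take $d\in\mathrm{Met}(X)$. Assume that either of the following is true: (1) the space $X$ contains a subset $S$ such that $S$ is uniformly homeomorphic to $X$ (with respect to $d$, i.e. $(S,d|_{S^2})$ is uniformly homeomorphic to $(X,d)$) and the closure $\mathrm{CL}_X(S)$ of $S$ in $X$ is a proper subset of $X$; (2) the space $X$ contains a closed proper subset $S$ homeomorphic to $X$. Then there exists an isometric embedding from $(X,d)$ into the space $(\mathrm{Met}(X),\mathcal{D}_X)$. Moreover, if $(X,d)$ is bounded, it can be isometrically embedded into $(\mathrm{BMet}(X),\mathcal{D}_X)$.
   Context: For a metrizable space $X$, $\mathrm{Met}(X)$ is the set of all metrics on $X$ that generate the given topology of $X$, and $\mathrm{BMet}(X)$ is the set of all bounded metrics in $\mathrm{Met}(X)$. The sup-metric is $\mathcal{D}_X(d,e)=\sup_{x,y\in X}|d(x,y)-e(x,y)|$ (a priori possibly taking the value $\infty$); subsets carry its restriction. An isometric embedding is a distance-preserving map (not necessarily surjective). A uniform homeomorphism is a bijection that is uniformly continuous together with its inverse. *)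

(* Defs.v *)
From HB Require Import structures.
From mathcomp Require Import all_boot all_order all_algebra.
From mathcomp Require Import all_classical all_reals all_analysis.

Set Implicit Arguments.
Unset Strict Implicit.
Unset Printing Implicit Defensive.

Import Order.TTheory GRing.Theory Num.Theory.
Import numFieldNormedType.Exports.

Local Open Scope classical_set_scope.
Local Open Scope ring_scope.

(* The library's [metricType] attaches one distinguished distance to a type.
   Here many metrics live on one topological space, so a metric is a plain
   function satisfying a predicate. *)
Definition is_metric (R : realType) (T : Type) (d : T -> T -> R) : Prop :=
  [/\ forall x y, 0 <= d x y,
      forall x y, d x y = 0 <-> x = y,
      forall x y, d x y = d y x &
      forall x y z, d x z <= d x y + d y z].

Definition dball (R : realType) (T : Type) (d : T -> T -> R) (x : T) (r : R)
  : set T := [set y | d x y < r].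

Definition generates_topology (R : realType) (X : topologicalType)
    (d : X -> X -> R) : Prop :=
  forall x : X, nbhs x = filter_from [set r : R | 0 < r] (dball d x).

Definition Met (R : realType) (X : topologicalType) : set (X -> X -> R) :=
  [set d | is_metric d /\ generates_topology d].

Definition bounded_dist (R : realType) (T : Type) (d : T -> T -> R) : Prop :=
  exists M : R, forall x y, d x y <= M.

Definition BMet (R : realType) (X : topologicalType) : set (X -> X -> R) :=
  [set d | Met d /\ bounded_dist d].

(* On an empty [X] this supremum is [-oo] rather than [0]; this is immaterial
   below, where it is only evaluated when [X] has a point. *)
Definition sup_dist (R : realType) (X : Type) (d e : X -> X -> R) : \bar R :=
  ereal_sup [set `|d p.1 p.2 - e p.1 p.2|%:E | p in [set: X * X]].

(* [f] maps the metric space [(T, d)] isometrically into the set [A], whose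
   distance [D] may a priori take infinite values. *)
Definition isometric_embedding (R : realType) (T U : Type)
    (d : T -> T -> R) (A : set U) (D : U -> U -> \bar R) (f : T -> U) : Prop :=
  (forall x, A (f x)) /\ (forall x y, D (f x) (f y) = (d x y)%:E).

Definition restrict_dist (R : realType) (T : Type) (d : T -> T -> R)
    (S : set T) : S -> S -> R :=
  fun x y => d (set_val x) (set_val y).

Definition uniformly_continuous (R : realType) (T U : Type)
    (d : T -> T -> R) (e : U -> U -> R) (f : T -> U) : Prop :=
  forall eps : R, 0 < eps -> exists2 delta : R, 0 < delta &
    forall x y, d x y < delta -> e (f x) (f y) < eps.

Definition uniformly_homeomorphic (R : realType) (T U : Type)
    (d : T -> T -> R) (e : U -> U -> R) : Prop :=
  exists (f : T -> U) (g : U -> T),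
    [/\ cancel f g, cancel g f,
        uniformly_continuous d e f & uniformly_continuous e d g].

Definition homeomorphic (T U : topologicalType) : Prop :=
  exists (f : T -> U) (g : U -> T),
    [/\ cancel f g, cancel g f, continuous f & continuous g].

(* Main.v *)
Require Import Defs.
From HB Require Import structures.
From mathcomp Require Import all_boot all_order all_algebra.
From mathcomp Require Import all_classical all_reals all_analysis.
From mathcomp Require Import ring lra.

(* The Kuratowski embedding kappa(x) = d(x, .) - d(p, .), with p a point outside
   the closure of S, is isometric for the sup norm.  Extend kappa o f : S ->
   l^oo(X) to a continuous K : X -> l^oo(X), take a continuous bump phi with
   phi = 0 on S and phi(p) = 1, and put
     D_x(u, v) = d(u, v) + |K_x(u) - K_x(v)|,  K_x = (1 - phi) K + phi kappa(x).
   Each D_x is d plus a continuous pseudometric, hence lies in Met(X).  Since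
   K_x - K_y = phi (kappa(x) - kappa(y)), one has |D_x - D_y| <= d(x, y), and
   D_x(p, s) = d(p, s) + d(x, f(s)) for s in S makes this an equality at (p, s)
   with f(s) = y.  Besides p, all that is needed of S is a map f of S onto X
   that is Cauchy at each point of the closure of S. *)

Set Implicit Arguments.
Unset Strict Implicit.
Unset Printing Implicit Defensive.

Import Order.TTheory GRing.Theory Num.Theory.
Import numFieldNormedType.Exports.

Local Open Scope classical_set_scope.
Local Open Scope ring_scope.

(** * Infima and suprema of ranges of bounded functions *)

Lemma inf_range_le (R : realType) (I : Type) (h : I -> R) (c : R) (i : I) :
  (forall j, c <= h j) -> inf (range h) <= h i.
Proof. by move=> hc; apply: ge_inf; [exists c => _ [j _ <-]|exists i]. Qed.

Lemma le_inf_range (R : realType) (I : Type) (h : I -> R) (c : R) (i : I) :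
  (forall j, c <= h j) -> c <= inf (range h).
Proof. by move=> hc; apply: lb_le_inf => [|_ [j _ <-]//]; exists (h i), i. Qed.

Lemma le_sup_range (R : realType) (I : Type) (h : I -> R) (c : R) (i : I) :
  (forall j, h j <= c) -> h i <= sup (range h).
Proof. by move=> hc; apply: ub_le_sup; [exists c => _ [j _ <-]|exists i]. Qed.

Lemma sup_range_le (R : realType) (I : Type) (h : I -> R) (c : R) (i : I) :
  (forall j, h j <= c) -> sup (range h) <= c.
Proof. by move=> hc; apply: ge_sup => [|_ [j _ <-]//]; exists (h i), i. Qed.

(** * Extending a nonnegative function from the range of [iota] to [X] *)

Section Extension.
Variables (R : realType) (X T : Type) (d : X -> X -> R) (iota : T -> X) (t0 : T).
Hypothesis d_metric : is_metric d.

Let d_ge0 x y : 0 <= d x y. Proof. by have [H _ _ _] := d_metric. Qed.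
Let dxx x : d x x = 0. Proof. by have [_ H _ _] := d_metric; apply/H. Qed.
Let dC x y : d x y = d y x. Proof. by have [_ _ H _] := d_metric. Qed.
Let dtri x y z : d x z <= d x y + d y z.
Proof. by have [_ _ _ H] := d_metric. Qed.

Definition gap (u : X) : R := inf (range (fun s => d u (iota s))).

Lemma gap_le u s : gap u <= d u (iota s).
Proof. exact: (@inf_range_le _ _ (fun s => d u (iota s)) 0). Qed.

Lemma gap_ge0 u : 0 <= gap u.
Proof. exact: le_inf_range t0 _. Qed.

Lemma gap_iota s : gap (iota s) = 0.
Proof. by apply/eqP; rewrite eq_le gap_ge0 andbT -(dxx (iota s)) gap_le. Qed.

Lemma gap_lipschitz u v : gap u <= d u v + gap v.
Proof.
rewrite -lerBlDl; apply: le_inf_range t0 _ => s.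
by rewrite lerBlDl (le_trans (gap_le u s)).
Qed.

Lemma gap_lt u r : gap u < r -> exists s, d u (iota s) < r.
Proof.
move=> ur; have [_ [s _ <-] sr] : exists2 y,
    range (fun s => d u (iota s)) y & y < r.
  by apply: inf_lt => //; exists (d u (iota t0)), t0.
by exists s.
Qed.

(* The limit of [G] at a point [u] of the closure of the range of [iota], taken
   as an upper limit so that it needs no existence proof. *)
Definition limval (G : T -> R) (u : X) : R :=
  inf [set y | exists2 r, 0 < r & forall s, d u (iota s) < r -> G s <= y].

(* Truncating the distance at 1 makes the penalty continuous in [u] uniformly in
   [s], off the closure; near the closure it is huge for every remote [s]. *)
Definition penalty (u : X) (s : T) : R :=
  Num.max 0 (Num.min (d u (iota s)) 1 - 2 * gap u) / gap u.

(** Off the closure, a variant of Hausdorff's extension formula $\inf_s (G(s) + d(u,s)/d(u,S) - 1)$,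
    where $S$ is the range of [iota]. *)
Definition ext (G : T -> R) (u : X) : R :=
  if gap u == 0 then limval G u else inf (range (fun s => G s + penalty u s)).

Lemma penalty_ge0 u s : 0 <= penalty u s.
Proof. by rewrite divr_ge0 ?gap_ge0// le_max lexx. Qed.

(** As [gap u = 0], every ball about [u] meets the range of [iota]. So each upper bound used in
    [limval] dominates some [G s'] within [eps] of [G s], and [G s + eps] is itself such a bound. *)
Lemma limval_near (G : T -> R) u r eps s : (forall s, 0 <= G s) ->
    gap u = 0 -> 0 < r ->
    (forall s s', d u (iota s) < r -> d u (iota s') < r ->
      `|G s - G s'| <= eps) ->
  d u (iota s) < r -> `|G s - limval G u| <= eps.
Proof.
move=> G_ge0 u0 r0 osc us.
have Gs : [set y | exists2 r, 0 < r & forall s, d u (iota s) < r -> G s <= y]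
    (G s + eps).
  by exists r => // s' us'; have := osc _ _ us' us; rewrite ler_norml; lra.
have pick r' : 0 < r' -> exists2 s', d u (iota s') < r & d u (iota s') < r'.
  move=> r'0; have [|s'] := @gap_lt u (Num.min r r').
    by rewrite u0 lt_min r0.
  by rewrite lt_min => /andP[]; exists s'.
have low : G s - eps <= limval G u.
  apply: lb_le_inf; first by exists (G s + eps).
  move=> y [r' r'0 Gy]; have [s' /(osc _ _ us) + /Gy] := pick _ r'0.
  by rewrite ler_norml; lra.
have upp : limval G u <= G s + eps.
  apply: ge_inf => //; exists 0 => y [r' r'0 Gy].
  by have [s' _ /Gy] := pick _ r'0; apply: le_trans.
by rewrite ler_norml; lra.
Qed.

Lemma ext_ge0 (G : T -> R) u : (forall s, 0 <= G s) -> 0 <= ext G u.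
Proof.
move=> G_ge0; rewrite /ext; case: eqP => u0; last first.
  by apply: le_inf_range t0 _ => s; rewrite addr_ge0 ?penalty_ge0.
have [[y Yy]|/forallNP noY] := pselect (exists y, exists2 r, 0 < r &
    forall s, d u (iota s) < r -> G s <= y); last first.
  (* If [G] is unbounded above on every ball about [u], [limval G u] is the infimum of the empty
     set, which is 0. *)
  by rewrite /limval (_ : mkset _ = set0) ?inf0//; apply/seteqP; split.
apply: lb_le_inf; first by exists y.
move=> z [r r0 Gz]; have [|s us] := @gap_lt u r; first by rewrite u0.
exact: le_trans (G_ge0 s) (Gz _ us).
Qed.

(** The numerator is 3-Lipschitz in [u] (1 from the truncated distance, 2 from [2 * gap u]) and at
    most 1 by truncation. With [gap v >= gap u / 2], the quotient has a bound free of [s]. *)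
Lemma penalty_near u v s : 0 < gap u -> d u v <= gap u / 2 ->
  `|penalty u s - penalty v s| <= d u v * (3 / gap u + 2 / gap u ^+ 2).
Proof.
move=> u0 uv.
have uv_gap := gap_lipschitz u v; have vu_gap := gap_lipschitz v u.
have dus := dtri u v (iota s); have dvs := dtri v u (iota s).
rewrite (dC v u) in vu_gap dvs.
have v0 : 0 < gap v by lra.
rewrite /penalty.
set Nu := Num.max 0 (Num.min (d u (iota s)) 1 - _).
set Nv := Num.max 0 (Num.min (d v (iota s)) 1 - _).
have NuNv : `|Nu - Nv| <= d u v * 3.
  rewrite /Nu /Nv !maxEle !minEle ler_norml.
  by do 4 case: ifPn; rewrite ?leNgt ?negbK => *; lra.
have Nv01 : 0 <= Nv <= 1.
  rewrite /Nv le_max lexx/= ge_max ler01/= lerBlDr ge_min.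
  by apply/orP; right; lra.
have iv_le : (gap v)^-1 <= 2 / gap u.
  by rewrite -invf_div lef_pV2 ?posrE ?divr_gt0//; lra.
have iu0 : 0 < (gap u)^-1 by rewrite invr_gt0.
have iv0 : 0 < (gap v)^-1 by rewrite invr_gt0.
have -> : Nu / gap u - Nv / gap v =
    (Nu - Nv) / gap u + Nv * ((gap v - gap u) / (gap u * gap v)).
  by field; rewrite !gt_eqF.
have gap_near : `|gap v - gap u| <= d u v by rewrite ler_norml; lra.
rewrite (le_trans (ler_normD _ _))// mulrDr lerD//.
  by rewrite mulrA normrM (gtr0_norm iu0) ler_wpM2r// ltW.
rewrite normrM ger0_norm; last by case/andP: Nv01.
rewrite -[leRHS]mul1r; case/andP: Nv01 => Nv0 Nv1; apply: ler_pM => //.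
rewrite normrM normfV (gtr0_norm (mulr_gt0 u0 v0)).
apply: ler_pM => //; first by rewrite invr_ge0 mulr_ge0 ?ltW.
by rewrite invfM expr2 invfM mulrCA ler_wpM2l// ltW.
Qed.

(** The bound on the penalty is uniform in [s], so it passes to the infimum. The modulus is
    independent of [G], which later yields equicontinuity. *)
Lemma ext_near_far (G : T -> R) u v : (forall s, 0 <= G s) ->
    0 < gap u -> d u v <= gap u / 2 ->
  `|ext G u - ext G v| <= d u v * (3 / gap u + 2 / gap u ^+ 2).
Proof.
move=> G_ge0 u0 uv; set K := d u v * _.
have v0 : 0 < gap v by have := gap_lipschitz u v; lra.
have Gp_ge0 x s : 0 <= G s + penalty x s by rewrite addr_ge0 ?penalty_ge0.
have inf_near x y : (forall s, penalty x s <= penalty y s + K) ->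
    inf (range (fun s => G s + penalty x s)) <=
    inf (range (fun s => G s + penalty y s)) + K.
  move=> xy; rewrite -lerBlDr; apply: le_inf_range t0 _ => s.
  have := @inf_range_le _ _ (fun s => G s + penalty x s) 0 s (Gp_ge0 x).
  by have := xy s; lra.
have pK s : `|penalty u s - penalty v s| <= K by exact: penalty_near.
rewrite /ext !gt_eqF// ler_distlC; apply/andP; split.
  by rewrite lerBlDr; apply: inf_near => s; have := pK s; rewrite ler_norml; lra.
by apply: inf_near => s; have := pK s; rewrite ler_norml; lra.
Qed.

(** If [v] is in the closure too, both values are close to a common [G s]. Otherwise an unpenalized
    [s] bounds [ext G v] above; for the lower bound, [G] is close to [ext G u] at near points, and
    remote points pay a large penalty. *)
Lemma ext_near_closure (G : T -> R) u r r' B eps : (forall s, 0 <= G s) ->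
    gap u = 0 -> 0 < r -> r <= 1 ->
    (forall s s', d u (iota s) < r -> d u (iota s') < r ->
      `|G s - G s'| <= eps) ->
    ext G u <= B -> r' * (B + 3) <= r -> r' * 3 <= r ->
  forall v, d u v < r' -> `|ext G u - ext G v| <= eps + eps.
Proof.
move=> G_ge0 u0 r0 r1 osc JB r'B r'3 v uv.
have J0 := ext_ge0 u G_ge0.
have GJ s : d u (iota s) < r -> `|G s - ext G u| <= eps.
  by move=> us; rewrite /ext u0 eqxx; apply: limval_near us.
have d0 := d_ge0 u v.
have [v0|v0] := eqVneq (gap v) 0.
  have uvr : 0 < r - d u v by lra.
  have sub s : d v (iota s) < r - d u v -> d u (iota s) < r.
    by have := dtri u v (iota s); lra.
  have [|s vs] := @gap_lt v (r - d u v); first by rewrite v0.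
  have us := GJ _ (sub _ vs).
  have : `|G s - ext G v| <= eps.
    rewrite {1}/ext v0 eqxx; apply: limval_near vs => // s1 s2 /sub h1 /sub.
    exact: osc.
  by move: us; rewrite !ler_norml; lra.
have vg : 0 < gap v by rewrite lt_neqAle eq_sym v0 gap_ge0.
have gv : gap v <= d u v by have := gap_lipschitz v u; rewrite u0 addr0 dC.
(* Within [2 * gap v] of [v] the penalty vanishes, and [r' * 3 <= r] keeps [s] within [r] of [u]. *)
have [|s vs] := @gap_lt v (2 * gap v); first by lra.
have us : d u (iota s) < r by have := dtri u v (iota s); lra.
have eps0 : 0 <= eps by apply: le_trans (GJ _ us).
have upp : ext G v <= G s.
  rewrite /ext (negbTE v0).
  apply: (@le_trans _ _ (G s + penalty v s)).
    apply: (@inf_range_le _ _ (fun s => G s + penalty v s) 0) => s'.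
    by rewrite addr_ge0 ?penalty_ge0.
  by rewrite /penalty max_l ?mul0r ?addr0// subr_le0 ge_min (ltW vs).
have low : ext G u - eps <= ext G v.
  rewrite {2}/ext (negbTE v0); apply: le_inf_range t0 _ => s'.
  have [us'|us'] := ltP (d u (iota s')) r.
    by have := GJ _ us'; have := penalty_ge0 v s'; rewrite ler_norml; lra.
  (* For remote [s'] the penalty alone suffices: [gap v <= d u v < r'] and [r' * (B + 3) <= r] give
     [(ext G u - eps + 2) * gap v <= r - d u v]. *)
  rewrite (@le_trans _ _ (penalty v s'))// ?lerDr// /penalty.
  rewrite ler_pdivlMr// le_max; apply/orP; right.
  have far : r - d u v <= Num.min (d v (iota s')) 1.
    by rewrite le_min; have := dtri u v (iota s'); lra.
  have : (ext G u - eps + 2) * gap v <= (B + 2) * d u v.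
    apply: (@le_trans _ _ ((B + 2) * gap v)); first by rewrite ler_wpM2r//; lra.
    by rewrite ler_wpM2l//; lra.
  have : d u v * (B + 3) <= r' * (B + 3) by rewrite ler_wpM2r//; lra.
  by move: far r'B; set D := Num.min _ _; lra.
by have := GJ _ us; rewrite !ler_norml; lra.
Qed.

(** * Extending a family of functions, uniformly in the index *)

Variables (W : Type) (G : W -> T -> R).
Hypothesis G_ge0 : forall w s, 0 <= G w s.
Hypothesis G_bounded : forall s, exists B, forall w, G w s <= B.
Hypothesis G_cauchy : forall u eps, 0 < eps -> exists2 r, 0 < r &
  forall s s', d u (iota s) < r -> d u (iota s') < r ->
  forall w, `|G w s - G w s'| <= eps.

Lemma ext_iota w s : ext (G w) (iota s) = G w s.
Proof.
rewrite /ext gap_iota eqxx; apply/esym/eqP; rewrite -subr_eq0 -normr_le0.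
apply/ler_addgt0Pr => eps eps0; rewrite add0r.
have [r r0 H] := G_cauchy (iota s) eps0.
apply: (@limval_near _ _ r) => //; rewrite ?gap_iota ?dxx// => *; exact: H.
Qed.

(** One [s] serves all [w], so pointwise bounds on the family survive extension. On the closure the
    1 is the Cauchy tolerance; off it, an [s] within [2 * gap u] has no penalty. *)
Lemma ext_le u : exists s, forall w, ext (G w) u <= G w s + 1.
Proof.
have [u0|u0] := eqVneq (gap u) 0.
  have [r r0 H] := G_cauchy u ltr01.
  have [|s us] := @gap_lt u r; first by rewrite u0.
  exists s => w; have := @limval_near (G w) u r 1 s (G_ge0 w) u0 r0.
  rewrite /ext u0 eqxx ler_norml => /(_ _ us) h.
  by have /andP[] := h (fun s s' us us' => H s s' us us' w); lra.
have [|s us] := @gap_lt u (2 * gap u).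
  by have := gap_ge0 u; rewrite le_eqVlt eq_sym (negbTE u0)/=; lra.
exists s => w; rewrite /ext (negbTE u0).
apply: (@le_trans _ _ (G w s + penalty u s)).
  apply: (@inf_range_le _ _ (fun s => G w s + penalty u s) 0) => s'.
  by rewrite addr_ge0 ?penalty_ge0.
rewrite lerD2l /penalty max_l ?mul0r// subr_le0 ge_min.
by rewrite (ltW us).
Qed.

Lemma ext_equicontinuous u eps : 0 < eps -> exists2 r, 0 < r &
  forall v w, d u v < r -> `|ext (G w) u - ext (G w) v| <= eps.
Proof.
move=> eps0; have [u0|u0] := eqVneq (gap u) 0.
  have [r1 r10 H] := G_cauchy u (divr_gt0 eps0 (@ltr0n R 2)).
  have [s sB] := ext_le u; have [C GC] := G_bounded s.
  (* With [B >= 0], the radius [r / (B + 3)] meets both smallness conditions of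
     [ext_near_closure]. *)
  set B := Num.max 0 (C + 1).
  have B0 : 0 <= B by rewrite le_max lexx.
  have CB : C + 1 <= B by rewrite le_max lexx orbT.
  set r := Num.min r1 1.
  have r0 : 0 < r by rewrite lt_min r10 ltr01.
  have B3 : 0 < B + 3 by lra.
  exists (r / (B + 3)); first exact: divr_gt0.
  move=> v w uv; rewrite [eps]splitr.
  apply: (@ext_near_closure (G w) u r (r / (B + 3)) B) => //.
  - by rewrite ge_min lexx orbT.
  - move=> s1 s2; rewrite !lt_min => /andP[h1 _] /andP[h2 _]; exact: H.
  - by have := sB w; have := GC w; lra.
  - by rewrite divfK ?gt_eqF.
  - by rewrite mulrAC ler_pdivrMr// ler_pM2l//; lra.
have ug : 0 < gap u by rewrite lt_neqAle eq_sym u0 gap_ge0.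
set K := 3 / gap u + 2 / gap u ^+ 2.
have K0 : 0 < K by rewrite addr_gt0 ?divr_gt0// exprn_gt0.
exists (Num.min (gap u / 2) (eps / K)); first by rewrite lt_min !divr_gt0.
move=> v w; rewrite lt_min => /andP[uv]; rewrite ltr_pdivlMr// => uvK.
exact: le_trans (ext_near_far (G_ge0 w) ug (ltW uv)) (ltW uvK).
Qed.

End Extension.

(** * Adding to a metric the oscillation of a family of functions *)

Section DistancePlusOscillation.
Variables (R : realType) (X W : Type) (d : X -> X -> R) (w0 : W).

Definition family_bounded (k : W -> X -> R) : Prop :=
  forall u, exists B, forall w, `|k w u| <= B.

Definition family_equicontinuous (k : W -> X -> R) : Prop :=
  forall u eps, 0 < eps -> exists2 r, 0 < r &
    forall v w, d u v < r -> `|k w u - k w v| <= eps.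

(** For a bounded family, the supremum is the sup-norm distance pulled back along $u \mapsto
    (k_w(u))_w$; equicontinuity is continuity of this map. *)
Definition add_osc (k : W -> X -> R) (u v : X) : R :=
  d u v + sup (range (fun w => `|k w u - k w v|)).

Lemma le_osc (k : W -> X -> R) u v w : family_bounded k ->
  `|k w u - k w v| <= sup (range (fun w => `|k w u - k w v|)).
Proof.
move=> kB; have [Bu uB] := kB u; have [Bv vB] := kB v.
apply: (@le_sup_range _ _ (fun w => `|k w u - k w v|) (Bu + Bv)) => w'.
exact: le_trans (ler_normB _ _) (lerD (uB w') (vB w')).
Qed.

Lemma osc_le (k : W -> X -> R) u v c : (forall w, `|k w u - k w v| <= c) ->
  sup (range (fun w => `|k w u - k w v|)) <= c.
Proof. exact: sup_range_le w0. Qed.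

Lemma add_osc_metric k : is_metric d -> family_bounded k ->
  is_metric (add_osc k).
Proof.
move=> [d0 deq dC dtri] kB.
have osc0 u v : 0 <= sup (range (fun w => `|k w u - k w v|)).
  by apply: le_trans (le_osc u v w0 kB).
split=> [x y|x y|x y|x y z]; rewrite /add_osc.
- by rewrite addr_ge0.
- split=> [xy|<-].
    by apply/deq; have := d0 x y; have := osc0 x y; lra.
  apply/eqP; rewrite (_ : d x x = 0); last exact/deq.
  by rewrite add0r eq_le osc0 andbT; apply: osc_le => w; rewrite subrr normr0.
- rewrite dC (_ : (fun w => _) = (fun w => `|k w y - k w x|))//.
  by apply/funext => w; rewrite distrC.
- rewrite addrACA lerD//; apply: osc_le => w.
  by rewrite (le_trans (ler_distD (k w y) _ _))// lerD// le_osc.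
Qed.

End DistancePlusOscillation.

(** Balls of [add_osc d k] lie in those of [d] because the oscillation is nonnegative;
    equicontinuity gives the converse refinement. *)
Lemma add_osc_Met (R : realType) (X : topologicalType) (W : Type) (w0 : W)
    (d : X -> X -> R) (k : W -> X -> R) :
    Met d -> family_bounded k -> family_equicontinuous d k -> Met (add_osc d k).
Proof.
move=> [dm dgen] kB kC; split; first exact: add_osc_metric.
move=> x; rewrite dgen; apply/seteqP; split=> U [r /= r0 rU].
  exists r => // y xy; apply: rU; apply: le_lt_trans xy.
  by rewrite lerDl (le_trans _ (le_osc x y w0 kB)).
have r2 : 0 < r / 2 by rewrite divr_gt0.
have r4 : 0 < r / 4 by rewrite divr_gt0.
have [r' r'0 kr'] := kC x _ r4.
exists (Num.min r' (r / 2)); first by rewrite /= lt_min r'0.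
move=> y; rewrite /dball /= lt_min => /andP[xy1 xy2]; apply: rU.
have : sup (range (fun w => `|k w x - k w y|)) <= r / 4.
  by apply: osc_le => // w; exact: kr'.
by rewrite /dball /= /add_osc; lra.
Qed.

Lemma sup_dist_eq (R : realType) (X : Type) (D E : X -> X -> R) (c : R)
    (p s : X) :
    (forall u v, `|D u v - E u v| <= c) -> `|D p s - E p s| = c ->
  sup_dist D E = c%:E.
Proof.
move=> DE DEps; apply/eqP; rewrite eq_le; apply/andP; split.
  by apply: ge_ereal_sup => _ [q _ <-]; rewrite lee_fin.
by apply: ereal_sup_ubound; exists (p, s); rewrite //= DEps.
Qed.

(** * The metrics [D_x] and the isometry *)

Section Embedding.
Variables (R : realType) (X : topologicalType) (T : Type) (d : X -> X -> R).
Variables (iota : T -> X) (f : T -> X) (g : X -> T) (p : X).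
Hypothesis d_Met : Met d.
Hypothesis gK : cancel g f.
Hypothesis f_cauchy : forall u eps, 0 < eps -> exists2 r, 0 < r &
  forall s s', d u (iota s) < r -> d u (iota s') < r -> d (f s) (f s') <= eps.
Hypothesis p_far : exists2 r, 0 < r & forall s, r <= d p (iota s).

Let d_metric : is_metric d. Proof. by have [] := d_Met. Qed.
Let d_ge0 x y : 0 <= d x y. Proof. by have [H _ _ _] := d_metric. Qed.
Let dxx x : d x x = 0. Proof. by have [_ H _ _] := d_metric; apply/H. Qed.
Let dC x y : d x y = d y x. Proof. by have [_ _ H _] := d_metric. Qed.
Let dtri x y z : d x z <= d x y + d y z.
Proof. by have [_ _ _ H] := d_metric. Qed.
Let t0 : T := g p.

Let d_near x y z : `|d x z - d y z| <= d x y.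
Proof.
have := dtri x y z; have := dtri y x z.
by rewrite (dC y x) ler_norml; lra.
Qed.

Let gap_p : 0 < gap d iota p.
Proof.
have [r r0 pr] := p_far; apply: lt_le_trans r0 _.
exact: le_inf_range t0 _.
Qed.

(* The summand [d (f s) p] makes the unbounded family of Kuratowski coordinates
   nonnegative, as [ext] requires.  It is half of [shifted p s], so the extension
   can be corrected by half of the extension of [shifted p]. *)
Definition shifted (w : X) (s : T) : R := d (f s) w - d p w + d (f s) p.

Lemma shifted_ge0 w s : 0 <= shifted w s.
Proof. by have := dtri p (f s) w; rewrite (dC p (f s)) /shifted; lra. Qed.

Lemma shifted_le w s : shifted w s <= 2 * d (f s) p.
Proof. by have := dtri (f s) p w; rewrite /shifted; lra. Qed.

Lemma shifted_cauchy u eps : 0 < eps -> exists2 r, 0 < r &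
  forall s s', d u (iota s) < r -> d u (iota s') < r ->
  forall w, `|shifted w s - shifted w s'| <= eps.
Proof.
move=> eps0; have [|r r0 H] := @f_cauchy u (eps / 2); first by rewrite divr_gt0.
exists r => // s s' us us' w; have := H s s' us us'.
have := d_near (f s) (f s') w; have := d_near (f s) (f s') p.
by rewrite /shifted !ler_norml; lra.
Qed.

(** Coordinate [w] of the map [K] that extends [kappa o f]. *)
Definition extended (w u : X) : R :=
  ext d iota (shifted w) u - ext d iota (shifted p) u / 2.

Let shifted_bounded s : exists B, forall w, shifted w s <= B.
Proof. by exists (2 * d (f s) p) => w; exact: shifted_le. Qed.

Lemma extended_iota w s : extended w (iota s) = d (f s) w - d p w.
Proof.
rewrite /extended !(ext_iota t0 d_metric shifted_ge0 shifted_cauchy).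
by rewrite /shifted dxx; lra.
Qed.

Lemma extended_le u : exists s, forall w, `|extended w u| <= 2 * d (f s) p + 1.
Proof.
have [s us] := ext_le t0 d_metric shifted_ge0 shifted_cauchy u.
exists s => w; have := us w; have := us p.
have := shifted_le w s; have := shifted_le p s.
have := ext_ge0 iota t0 d_metric u (shifted_ge0 w).
have := ext_ge0 iota t0 d_metric u (shifted_ge0 p).
by rewrite /extended ler_norml; lra.
Qed.

Lemma extended_equicontinuous : family_equicontinuous d extended.
Proof.
move=> u eps eps0; have [|r r0 H] :=
  ext_equicontinuous t0 d_metric shifted_ge0 shifted_bounded shifted_cauchy u
    (eps := eps / 2); first by rewrite divr_gt0.
exists r => // v w uv; have := H v w uv; have := H v p uv.
by rewrite /extended !ler_norml; lra.
Qed.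

Definition bump (u : X) : R := Num.min 1 (gap d iota u / gap d iota p).

Lemma bump01 u : 0 <= bump u <= 1.
Proof.
by rewrite /bump le_min ler01 divr_ge0 ?(gap_ge0 _ t0 d_metric)//= ge_min lexx.
Qed.

Lemma bump_near u v : `|bump u - bump v| <= d u v / gap d iota p.
Proof.
have near x y : gap d iota x / gap d iota p <=
    gap d iota y / gap d iota p + d x y / gap d iota p.
  by rewrite -mulrDl ler_pM2r ?invr_gt0// addrC (gap_lipschitz iota t0 d_metric).
have d0 : 0 <= d u v / gap d iota p by rewrite divr_ge0// ltW.
have := near u v; have := near v u; rewrite (dC v u) /bump.
set a := gap d iota u / _; set b := gap d iota v / _ => *.
by rewrite !minEle ler_norml; do 2 case: ifPn; rewrite -?ltNge => *; lra.
Qed.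

Lemma bump_iota s : bump (iota s) = 0.
Proof.
by rewrite /bump (gap_iota iota t0 d_metric) mul0r min_r.
Qed.

Lemma bump_p : bump p = 1.
Proof. by rewrite /bump divff ?gt_eqF// min_l. Qed.

(** Coordinate [w] of [K_x], written as [K + phi (kappa(x) - K)]. *)
Definition coord (x w u : X) : R :=
  extended w u + bump u * (d x w - d p w - extended w u).

Lemma coord_le x u : exists s, forall w,
  `|coord x w u| <= 2 * d (f s) p + 1 + d x p.
Proof.
have [s us] := extended_le u; exists s => w.
have -> : coord x w u = (1 - bump u) * extended w u + bump u * (d x w - d p w).
  by rewrite /coord; ring.
have /andP[b0 b1] := bump01 u.
rewrite (le_trans (ler_normD _ _))// !normrM lerD//.
  by rewrite ger0_norm ?subr_ge0// (le_trans _ (us w))// ler_piMl//; lra.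
by rewrite ger0_norm// (le_trans _ (d_near x p w))// ler_piMl.
Qed.

Lemma coord_bounded x : family_bounded (coord x).
Proof.
by move=> u; have [s us] := coord_le x u; exists (2 * d (f s) p + 1 + d x p).
Qed.

Lemma coord_equicontinuous x : family_equicontinuous d (coord x).
Proof.
move=> u eps eps0; have [s us] := extended_le u.
set B := 2 * d (f s) p + 1 in us.
have B0 : 0 < B + d x p + 1.
  by have := d_ge0 (f s) p; have := d_ge0 x p; rewrite /B; lra.
have eps2 : 0 < eps / 2 by rewrite divr_gt0.
have [r r0 H] := @extended_equicontinuous u _ eps2.
exists (Num.min r (eps / 2 * gap d iota p / (B + d x p + 1))).
  by rewrite lt_min r0/= !(divr_gt0, mulr_gt0).
move=> v w; rewrite lt_min => /andP[/H uv]; rewrite ltr_pdivlMr// => uv2.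
(* Product rule: the weight [1 - bump v] is at most 1, and the last factor is bounded by [B + d x p]
   uniformly in [w]. *)
have -> : coord x w u - coord x w v =
    (1 - bump v) * (extended w u - extended w v) +
    (bump u - bump v) * (d x w - d p w - extended w u).
  by rewrite /coord; ring.
have /andP[b0 b1] := bump01 v.
rewrite [eps]splitr (le_trans (ler_normD _ _))// !normrM lerD//.
  rewrite ger0_norm ?subr_ge0// (le_trans _ (uv w))// ler_piMl//; lra.
apply: (@le_trans _ _ (d u v / gap d iota p * (B + d x p + 1))).
  apply: ler_pM => //; first exact: bump_near.
  by have := us w; have := d_near x p w; rewrite !ler_norml; lra.
by rewrite mulrAC ler_pdivrMr// ltW.
Qed.

(** Changing [x] to [y] changes the increment by [(bump u - bump v) * (d x w - d y w)], and [bump]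
    takes values in [0, 1]. *)
Lemma coord_near x y u v w :
  `|coord x w u - coord x w v| <= `|coord y w u - coord y w v| + d x y.
Proof.
rewrite -lerBlDl (le_trans (lerB_dist _ _))//.
have -> : coord x w u - coord x w v - (coord y w u - coord y w v) =
    (bump u - bump v) * (d x w - d y w).
  by rewrite /coord; ring.
rewrite normrM (le_trans _ (d_near x y w))// ler_piMl//.
by have := bump01 u; have := bump01 v; rewrite ler_norml; lra.
Qed.

Lemma add_osc_near x y u v :
  `|add_osc d (coord x) u v - add_osc d (coord y) u v| <= d x y.
Proof.
have near a b : sup (range (fun w => `|coord a w u - coord a w v|)) <=
    sup (range (fun w => `|coord b w u - coord b w v|)) + d a b.
  apply: (osc_le p) => w; apply: le_trans (coord_near a b u v w) _.
  by rewrite lerD2r (le_osc _ _ _ (coord_bounded b)).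
have := near x y; have := near y x; rewrite (dC y x) /add_osc.
by rewrite ler_norml; lra.
Qed.

Lemma add_osc_p_iota x s :
  add_osc d (coord x) p (iota s) = d p (iota s) + d x (f s).
Proof.
have coordE w : coord x w p - coord x w (iota s) = d x w - d (f s) w.
  by rewrite /coord bump_p bump_iota extended_iota; ring.
congr (_ + _); apply/eqP; rewrite eq_le; apply/andP; split.
  by apply: (osc_le p) => w; rewrite coordE.
(* The supremum of [|d x w - d (f s) w|] over [w] is attained at [w = f s]. *)
have := le_osc p (iota s) (f s) (coord_bounded x).
by rewrite coordE dxx subr0 ger0_norm.
Qed.

Lemma add_osc_sup_dist x y :
  sup_dist (add_osc d (coord x)) (add_osc d (coord y)) = (d x y)%:E.
Proof.
(* Since [f (g y) = y], at the pair [(p, iota (g y))] the two metrics exceed [d p (iota (g y))] by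
   [d x y] and 0. *)
apply: (sup_dist_eq (p := p) (s := iota (g y))); first exact: add_osc_near.
by rewrite !add_osc_p_iota gK dxx addr0 [d p _ + _]addrC addrK ger0_norm.
Qed.

Lemma Met_embedding : exists F : X -> (X -> X -> R),
  isometric_embedding d (@Met R X) (@sup_dist R X) F.
Proof.
exists (fun x => add_osc d (coord x)); split; last exact: add_osc_sup_dist.
move=> x; apply: (add_osc_Met p d_Met); first exact: coord_bounded.
exact: coord_equicontinuous.
Qed.

Lemma BMet_embedding : bounded_dist d -> exists F : X -> (X -> X -> R),
  isometric_embedding d (@BMet R X) (@sup_dist R X) F.
Proof.
move=> [M dM].
exists (fun x => add_osc d (coord x)); split; last exact: add_osc_sup_dist.
move=> x; split.
  apply: (add_osc_Met p d_Met); first exact: coord_bounded.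
  exact: coord_equicontinuous.
(* Each coordinate is at most [2 * M + 1 + M] in absolute value, and an increment at most twice
   that. *)
exists (M + 2 * (2 * M + 1 + M)) => u v; rewrite lerD//.
apply: (osc_le p) => w.
have [s us] := coord_le x u; have [s' vs] := coord_le x v.
have := us w; have := vs w; have := dM (f s) p; have := dM (f s') p.
by have := dM x p; rewrite !ler_norml; lra.
Qed.

End Embedding.

(** * Reducing both hypotheses to a far point and a Cauchy surjection *)

Theorem theorem1p4 (R : realType) (X : topologicalType) (d : X -> X -> R)
  (d_Met : Met d)
  (hX :
    (exists S : set X,
        uniformly_homeomorphic (restrict_dist d (S := S)) d /\
        closure S `<` [set: X])
    \/
    (exists S : set X,
        [/\ closed S, S `<` [set: X] & homeomorphic (set_type S) X])) :
  (exists f : X -> (X -> X -> R),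
      isometric_embedding d (@Met R X) (@sup_dist R X) f) /\
  (bounded_dist d ->
   exists f : X -> (X -> X -> R),
      isometric_embedding d (@BMet R X) (@sup_dist R X) f).
Proof.
have [[d_ge0 deq dC dtri] dgen] := d_Met.
have far (S : set X) p : ~ closure S p ->
    exists2 r, 0 < r & forall s : S, r <= d p (set_val s).
  move=> /existsNP[U /not_implyP[]]; rewrite dgen => -[r /= r0 rU] SU.
  exists r => // s; rewrite leNgt; apply/negP => ps; apply: SU.
  by exists (set_val s); split; [exact: set_valP|exact: rU].
suff [T [iota [f [g [p [gK f_cauchy p_far]]]]]] :
    exists (T : Type) (iota : T -> X) (f : T -> X) (g : X -> T) (p : X),
    [/\ cancel g f,
      forall u eps, 0 < eps -> exists2 r, 0 < r & forall s s',
        d u (iota s) < r -> d u (iota s') < r -> d (f s) (f s') <= eps &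
      exists2 r, 0 < r & forall s, r <= d p (iota s)].
  split; first exact: (Met_embedding d_Met gK f_cauchy p_far).
  exact: (BMet_embedding d_Met gK f_cauchy p_far).
have proper_ex (A : set X) : A `<` [set: X] -> exists p, ~ A p.
  by move=> [_ /existsNP[p /not_implyP[_ Ap]]]; exists p.
case: hX => [[S [[f [g [_ gK f_unif _]]] /proper_ex[p /far Sp]]]|
             [S [S_closed /proper_ex[p Sp] [f [g [_ gK f_cont _]]]]]].
  exists S, set_val, f, g, p; split=> // u eps /f_unif[r r0 fr].
  (* Two points within [r / 2] of [u] are within [r] of each other, so uniform continuity applies
     even when [u] is not in [S]. *)
  exists (r / 2) => [|s s' us us']; first by rewrite divr_gt0.
  apply/ltW/fr; rewrite /restrict_dist.
  have := dtri (set_val s) u (set_val s'); rewrite (dC _ u).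
  lra.
exists S, set_val, f, g, p; split=> //; last first.
  by apply: far => /S_closed.
(* Off the closed set [S], a small ball about [u] misses [S] and the Cauchy condition is vacuous; on
   [S] it follows from continuity of [f] at [u]. *)
move=> u eps eps0; have [uS|uS] := pselect (S u); last first.
  have [|r r0 ur] := @far S u; first by move=> /S_closed.
  by exists r => // s s'; rewrite ltNge ur.
pose s0 : S := exist _ u (mem_set uS).
have : nbhs (f s0) (dball d (f s0) (eps / 2)).
  by rewrite dgen; exists (eps / 2) => //=; rewrite divr_gt0.
(* Neighbourhoods in [S] contain traces of open sets [V] of [X], which contain [d]-balls about
   [u]. *)
move=> /f_cont [_ [[V oV <-] /= Vs0 sub]].
have : nbhs u V by exact: open_nbhs_nbhs.
rewrite dgen => -[r /= r0 rV]; exists r => // s s' us us'.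
have := sub s (rV _ us); have := sub s' (rV _ us').
rewrite /dball/= => h1 h2; have := dtri (f s) (f s0) (f s').
by rewrite (dC (f s) (f s0)); lra.
Qed.
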